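(* Let $F_1,F_2\in\mathcal{E}$ be probability distributions with positive Lebesgue densities $f_1,f_2$ on $(0,\infty)$, and assume that the following conditions hold: 1. the density $f_1$ has bounded increase with $\delta_{f_1}>0$; 2. $\delta_{\overline F_1}<\delta_{\overline F_2}$, and $\liminf_{x\to\infty}x^{\delta}\,\overline F_1(x)>0$ for some $\delta\in[\delta_{\overline F_1},\delta_{\overline F_2})$. Then the convolution $F_1\ast F_2$ belongs to $\mathcal{E}$.
   Context: $\overline F=1-F$ is the right tail of $F$. The convolution $F_1\ast F_2$ is the distribution with tail $\overline{F_1\ast F_2}(x)=\overline F_2(x)+\int_0^x\overline F_1(x-y)\,dF_2(y)$. $F\in\mathcal{E}$ (extended rapidly varying tail) means that $\limsup_{x\to\infty}\overline F(ux)/\overline F(x)<1$ for some $u>1$. For a positive function $g$ on $(0,\infty)$ (here $g=f_1$, $\overline F_1$ or $\overline F_2$), the (sign-normalized) lower Matuszewska index $\delta_g\in[-\infty,\infty]$ is the supremum of those $\delta\in\mathbb{R}$ for which there is a constant $C>0$ such that for every $U>1$, as $x\to\infty$, $g(ux)/g(x)\le C(1+o(1))u^{-\delta}$ uniformly in $u\in[1,U]$ (with $\sup\emptyset=-\infty$). A density $f$ has bounded increase if $\delta_f>-\infty$. *)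

(* Defs.v *)
From HB Require Import structures.
From mathcomp Require Import all_boot all_order all_algebra.
From mathcomp Require Import all_classical all_reals all_analysis.
Set Implicit Arguments.
Unset Strict Implicit.
Unset Printing Implicit Defensive.
Import Order.TTheory GRing.Theory Num.Theory.
Import numFieldNormedType.Exports.
Local Open Scope classical_set_scope.
Local Open Scope ring_scope.

(* The library's cumulative functions tending to 0 at -oo and to 1 at +oo are
   the distribution functions of the probability measures on the line. *)
Notation distrib_fun R := (cumulativeBounded (0 : R) (1 : R)).

Definition tail {R : realType} (F : R -> R) (x : R) : R := 1 - F x.

(* Only the values of f on ]0, +oo[ matter; the integral is over the empty set
   for x <= 0, so that F vanishes there. *)
Definition positive_density {R : realType} (F f : R -> R) : Prop :=
  [/\ measurable_fun (`]0, +oo[ : set R) f,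
      forall x, 0 < x -> 0 < f x &
      forall x, (F x)%:E = (\int[lebesgue_measure]_(y in `]0%R, x]) (f y)%:E)%E].

(* dF2 is the Lebesgue-Stieltjes measure of F2. The formula is that of
   distributions carried by [0, +oo[; for x < 0 it gives the tail of F2. *)
Definition convolution {R : realType} (F1 F2 : distrib_fun R) (x : R) : R :=
  1 - (tail F2 x +
       \int[lebesgue_stieltjes_measure F2]_(y in `[0, x]) tail F1 (x - y)).

(* Meant for F with positive tail (otherwise the quotient is eventually
   0 / 0 = 0). *)
Definition extended_rapid_variation {R : realType} (F : R -> R) : Prop :=
  exists2 u : R, 1 < u &
    (limf_esup (fun x : R => (tail F (u * x) / tail F x)%:E) (+oo_R) < 1)%E.

(* The function e is the o(1) term; it may depend on U, while C may not. *)
Definition matuszewska_bound {R : realType} (g : R -> R) (delta : R) : Prop :=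
  exists2 C : R, 0 < C &
    forall U : R, 1 < U ->
      exists2 e : R -> R, e x @[x --> +oo] --> (0 : R) &
        \forall x \near +oo, forall u : R, 1 <= u <= U ->
          g (u * x) / g x <= C * (1 + e x) * u `^ (- delta).

Definition lower_matuszewska {R : realType} (g : R -> R) : \bar R :=
  ereal_sup [set delta%:E | delta in matuszewska_bound g].

Definition bounded_increase {R : realType} (f : R -> R) : Prop :=
  (-oo < lower_matuszewska f)%E.

(* Main.v *)
Require Import Defs.
From mathcomp Require Import all_boot all_order all_algebra.
From mathcomp Require Import all_classical all_reals all_analysis.
From mathcomp Require Import ring lra.
Import Order.TTheory GRing.Theory Num.Theory.
Import numFieldNormedType.Exports.
Local Open Scope classical_set_scope.
Local Open Scope ring_scope.

(** Write T1, T2 for the tails of F1, F2 and X1, X2 for independent variables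
    with these laws. Since y <= x/2 gives u x - y >= u (x - y), the decay
    T1 (u z) <= c T1 z for large z transfers to the event X2 <= x/2, whence
    P(X1 + X2 > u x) <= T2 (x/2) + c P(X1 + X2 > x). The error T2 (x/2) is
    negligible with respect to T1 x, hence to P(X1 + X2 > x): for delta below
    the Matuszewska index of T2, x^delta T2 x tends to 0, whereas
    x^delta T1 x stays bounded away from 0. *)

(** * Eventual bounds and upper or lower limits *)

Lemma limf_esup_lt_near (R : realType) (T : choiceType) (X : filteredType T) (G : set_system X)
    (GF : Filter G) (f : X -> R) (a : R) :
  (limf_esup (fun x => (f x)%:E) G < a%:E)%E ->
  exists2 c : R, c < a & \forall x \near G, f x <= c.
Proof.
move=> /ereal_inf_ltP[_ [V GV <-]].
have fV x : V x -> ((f x)%:E <= ereal_sup [set (f y)%:E | y in V])%E.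
  by move=> Vx; apply: ereal_sup_ubound; exists x.
(* The upper limit is an infimum of suprema, so the supremum over one member [V] is already below
   [a]. If finite it serves as [c]; if it is [-oo], then [V] is empty and any [c < a] will do. *)
case: (ereal_sup _) fV => [s| |] fV // sa.
- by exists s; [rewrite -lte_fin|apply: filterS GV => x /fV; rewrite lee_fin].
- by exists (a - 1); [rewrite ltrBlDr ltrDl|apply: filterS GV => x /fV].
Qed.

Lemma limf_esup_near_le (R : realType) (T : choiceType) (X : filteredType T) (G : set_system X)
    (f : X -> R) (c : R) : (\forall x \near G, f x <= c) ->
  (limf_esup (fun x => (f x)%:E) G <= c%:E)%E.
Proof.
move=> fc; apply: (@le_trans _ _
  (ereal_sup [set (f x)%:E | x in [set x | f x <= c]])).
  by apply: ereal_inf_lbound; exists [set x | f x <= c].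
by apply: ge_ereal_sup => _ [x xc <-]; rewrite lee_fin.
Qed.

Lemma limf_einf_gt_near (R : realType) (T : choiceType) (X : filteredType T) (G : set_system X)
    (GF : Filter G) (f : X -> R) (a : R) :
  (a%:E < limf_einf (fun x => (f x)%:E) G)%E ->
  exists2 c : R, a < c & \forall x \near G, c <= f x.
Proof.
rewrite /limf_einf lteNr -EFinN => /limf_esup_lt_near[c ca cf].
by exists (- c); [rewrite ltrNr|apply: filterS cf => x; rewrite lerNl].
Qed.

(** * Distribution tails and the lower Matuszewska index *)

Section tails.
Context {R : realType}.
Implicit Types (F : distrib_fun R) (g : R -> R).

Lemma tail_nonincreasing F : {homo tail F : x y /~ x <= y}.
Proof. by move=> x y xy; rewrite /tail lerD2l lerN2 cumulative_is_nondecreasing. Qed.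

Lemma tail_ge0 F x : 0 <= tail F x.
Proof.
rewrite subr_ge0; apply: (cvgr_to_ge (cumulativey F)).
near=> y; apply: cumulative_is_nondecreasing.
by near: y; apply: nbhs_pinfty_ge; rewrite num_real.
Unshelve. all: by end_near. Qed.

Lemma tail_le1 F x : tail F x <= 1.
Proof.
rewrite gerBl; apply: (cvgr_to_le (cumulativeNy F)).
near=> y; apply: cumulative_is_nondecreasing.
by near: y; apply: nbhs_ninfty_le; rewrite num_real.
Unshelve. all: by end_near. Qed.

Lemma positive_density_at0 {F f} : positive_density F f -> F 0 = 0.
Proof. by case=> _ _ /(_ 0); rewrite set_itvoc0 integral_set0 => -[]. Qed.

Lemma geometric_le (z a e : R) : 0 <= z < 1 -> 0 < e ->
  exists n, z ^+ n * a <= e.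
Proof.
move=> /andP[z0 z1] e0.
have : `|z| < 1 by rewrite ger0_norm.
move=> /(cvg_geometric a) /(cvgr_le _) /(_ e e0) [n _ nP].
by exists n; rewrite mulrC; apply: (nP n) => /=.
Qed.

(** Monotonicity keeps the quotient [g (u * x) / g x] at most 1, so the exponent 0 is admissible
    with [C = 1] and zero error term. *)
Lemma lower_matuszewska_ge0 g : (forall x, 0 <= g x) ->
  {homo g : x y /~ x <= y} -> (0 <= lower_matuszewska g)%E.
Proof.
move=> g0 gn; apply: ereal_sup_ubound; exists 0 => //.
exists 1 => // U U1; exists (fun=> 0); first exact: cvg_cst.
near=> x => u /andP[u1 _].
rewrite addr0 !mul1r oppr0 powRr0.
have [->|gx0] := eqVneq (g x) 0; first by rewrite invr0 mulr0.
rewrite ler_pdivrMr ?lt_neqAle 1?eq_sym ?gx0 ?g0// mul1r gn// ler_peMl//.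
Unshelve. all: by end_near. Qed.

(** The surplus exponent [d0 - d] beats the constant [C] once the dilation is large; iterating this
    one dilation then gives geometric decay. *)
Lemma matuszewska_bound_cvg0 g (d0 d : R) : (forall x, 0 <= g x) ->
  {homo g : x y /~ x <= y} -> matuszewska_bound g d0 -> 0 <= d < d0 ->
  x `^ d * g x @[x --> +oo] --> 0.
Proof.
move=> g0 gn [C C0 gC] /andP[d_ge0 dd0].
(* For the dilation factor U below, q at least halves from x to U x, for large x. *)
pose q x := x `^ d * g x.
have q0 x : 0 <= q x by rewrite mulr_ge0 ?powR_ge0.
(* Here [U] to the power [d0 - d] is [4 * C + 2]. Once the error term is at most 1, dilation by [U]
   multiplies [q] by at most [2 * C / (4 * C + 2)], which is below one half; the summand 2 also
   ensures [U > 1]. *)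
pose U := (4 * C + 2) `^ (d0 - d)^-1.
have U1 : 1 < U.
  have := @gt0_ltr_powR R (d0 - d)^-1 _ 1 (4 * C + 2).
  by rewrite powR1 invr_gt0 subr_gt0 !nnegrE; apply => //; lra.
have U0 : 0 < U by lra.
have UE : U `^ d = (4 * C + 2)^-1 * U `^ d0.
  have UdE : U `^ (d0 - d) = 4 * C + 2.
    by rewrite /U -powRrM mulVf ?powRr1 ?subr_eq0 ?(gt_eqF dd0)//; lra.
  have -> : d0 = d + (d0 - d) by rewrite subrKC.
  by rewrite powRD ?(gt_eqF U0) ?implybT// UdE; field; lra.
have [e e0 gU] := gC U U1.
have [x0 [x0_gt0 qU]] : exists x0, 0 < x0 /\
    forall x, x0 <= x -> q (U * x) <= 2^-1 * q x.
  suff: \forall x \near +oo, q (U * x) <= 2^-1 * q x.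
    case=> M [_ MP]; exists (`|M| + 1); split; first by rewrite ltr_wpDl.
    move=> x Mx; apply: MP; have := ler_norm M; lra.
  near=> x.
  have x_gt0 : 0 < x by near: x; exact: nbhs_pinfty_gt.
  have e1 : e x <= 1.
    near: x; apply: (cvgr_le _ e0) => //; exact: ltr01.
  have : g (U * x) / g x <= C * (1 + e x) * U `^ (- d0).
    have : forall u, 1 <= u <= U ->
        g (u * x) / g x <= C * (1 + e x) * u `^ (- d0).
      by near: x.
    by apply; rewrite lexx ltW.
  have Ug : g (U * x) <= g x by apply: gn; rewrite ler_peMl// ltW.
  have gU0 := g0 (U * x).
  have Ud0 := powR_gt0 d0 U0.
  have xd := powR_ge0 x d.
  have -> : q (U * x) = (4 * C + 2)^-1 * U `^ d0 * x `^ d * g (U * x).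
    by rewrite /q powRM ?UE// ltW.
  rewrite powRN /q.
  (* Where [g x = 0] the quotient is 0 by convention and carries no information; monotonicity gives
     [g (U * x) = 0] instead. *)
  have [gx0|gx0] := eqVneq (g x) 0.
    have -> : g (U * x) = 0 by lra.
    by rewrite gx0 !mulr0.
  have gx_gt0 : 0 < g x by rewrite lt_neqAle eq_sym gx0 g0.
  rewrite ler_pdivrMr// => gUx.
  have gUx2 : U `^ d0 * g (U * x) <= 2 * C * g x.
    apply: (@le_trans _ _ (C * (1 + e x) * g x)); last first.
      by rewrite ler_pM2r//; nra.
    have -> : C * (1 + e x) * g x = U `^ d0 * (C * (1 + e x) / U `^ d0 * g x).
      by field; rewrite gt_eqF.
    by rewrite ler_pM2l.
  have C4 : 0 < 4 * C + 2 by lra.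
  have -> : (4 * C + 2)^-1 * U `^ d0 * x `^ d * g (U * x) =
            x `^ d * ((4 * C + 2)^-1 * (U `^ d0 * g (U * x))) by ring.
  rewrite [leRHS]mulrCA; apply: ler_wpM2l => //.
  rewrite mulrC ler_pdivrMr//; nra.
have Un_ge1 n : 1 <= U ^+ n by rewrite exprn_ege1// ltW.
(* [M] bounds [q] on the first block, from [x0] to [U * x0]: the power is largest at the right end,
   [g] at the left end. Contraction by [U] carries the bound to all later blocks. *)
pose M := (U * x0) `^ d * g x0.
have qM n x : x0 <= x <= U ^+ n * (U * x0) -> q x <= M.
  elim: n x => [|n IH] x /andP[x0x xU].
    rewrite mul1r in xU; apply: ler_pM; rewrite ?powR_ge0//; last exact: gn.
    by apply: ge0_ler_powR => //; rewrite nnegrE; nra.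
  have [xU0|xU0] := leP x (U * x0).
    by apply: IH; rewrite x0x (le_trans xU0)// ler_peMl//; nra.
  have xE : x = U * (x / U) by field; rewrite gt_eqF.
  have x0xU : x0 <= x / U by rewrite ler_pdivlMr// mulrC ltW.
  rewrite xE (le_trans (qU _ x0xU))//.
  have : q (x / U) <= M.
    apply: IH; rewrite x0xU ler_pdivrMr// (le_trans xU)// exprS.
    by rewrite [leRHS]mulrC !mulrA.
  by have := q0 (x / U); lra.
have U_unbounded y : exists n, y <= U ^+ n.
  have [|n] := @geometric_le U^-1 y 1 _ ltr01; first by rewrite invr_ge0 ltW ?invf_lt1.
  by exists n; move: p; rewrite exprVn mulrC ler_pdivrMr ?mul1r ?exprn_gt0.
have q_le_M x : x0 <= x -> q x <= M.
  move=> x0x; have [n xn] := U_unbounded (x / (U * x0)).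
  by apply: (qM n); rewrite x0x -ler_pdivrMr// mulr_gt0.
(* Beyond [U ^+ n * x0], a point can be divided by [U] as many as [n] times while staying above
   [x0], and each division gains a factor one half. *)
have q_geo n x : U ^+ n * x0 <= x -> q x <= 2^-1 ^+ n * M.
  elim: n x => [|n IH] x; first by rewrite !mul1r; exact: q_le_M.
  move=> xU.
  have xE : x = U * (x / U) by field; rewrite gt_eqF.
  have xU' : U ^+ n * x0 <= x / U.
    by rewrite ler_pdivlMr// (le_trans _ xU)// exprS mulrC mulrA.
  rewrite xE (le_trans (qU _ _)) ?exprS -?mulrA ?ler_pM2l ?invr_gt0// ?IH//.
  by rewrite (le_trans _ xU')// ler_peMl// ltW.
apply/cvgrPdist_le => eps eps0.
have M0 : 0 <= M by rewrite mulr_ge0 ?powR_ge0.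
have [n nM] : exists n, 2^-1 ^+ n * M <= eps.
  by apply: geometric_le => //; lra.
near=> x.
by rewrite sub0r normrN (ger0_norm (q0 x)) (le_trans _ nM)// q_geo.
Unshelve. all: by end_near. Qed.

(** * The Stieltjes measure of [F2] and the tail of the convolution *)

Lemma lebesgue_stieltjes_itvoc F (a b : R) : a <= b ->
  lebesgue_stieltjes_measure F `]a, b] = (F b - F a)%:E.
Proof.
move=> ab; rewrite /lebesgue_stieltjes_measure /measure_extension/=.
by rewrite measurable_mu_extE/= ?wlength_itv_bnd//; exact: is_ocitv.
Qed.

Context (F1 F2 : distrib_fun R).
Let mu := lebesgue_stieltjes_measure F2.

Lemma integrable_tail_shift (D : set (measurableTypeR R)) (x : R) :
  measurable D -> mu.-integrable D (fun y => (tail F1 (x - y))%:E).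
Proof.
move=> mD; apply: (@measurable_bounded_integrable _ _ _ mu (fun y => tail F1 (x - y))) => //.
- by rewrite (le_lt_trans (probability_le1 mu mD))// ltry.
- apply: (measurable_realfun.nondecreasing_measurable mD) => y z yz; apply: tail_nonincreasing.
  by rewrite lerD2l lerN2.
- exists 1; split; first exact: num_real.
  move=> M M1 y _ /=; rewrite ger0_norm ?tail_ge0//.
  by rewrite (le_trans _ (ltW M1))// tail_le1.
Qed.

Lemma tail_convolution (x : R) : tail (convolution F1 F2) x =
  tail F2 x + \int[mu]_(y in `[0, x]) tail F1 (x - y).
Proof. by rewrite {1}/tail opprB addrC subrK. Qed.

(** In terms of independent variables, the event [X1 > x], [0 <= X2 <= x] is contained in
    [X1 + X2 > x]. *)
Lemma tail_convolution_ge {x : R} : 0 <= x -> F2 0 = 0 ->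
  tail F1 x * F2 x <= tail (convolution F1 F2) x.
Proof.
move=> x0 F20; rewrite tail_convolution.
have mI : measurable (`[0, x] : set (measurableTypeR R)) by exact: measurable_itv.
have ITx : \int[mu]_(y in `[0, x]) tail F1 x <= \int[mu]_(y in `[0, x]) tail F1 (x - y).
  apply: le_Rintegral => //.
  - by apply: finite_measure_integrable_cst.
  - exact: integrable_tail_shift.
  - by move=> y /=; rewrite in_itv/= => /andP[y0 _]; apply: tail_nonincreasing; lra.
apply: le_trans (ler_wpDl (tail_ge0 F2 x) ITx).
rewrite Rintegral_cst// ler_wpM2l ?tail_ge0//.
rewrite -lee_fin fineK ?fin_num_measure//.
(* Since [F2 0 = 0], the value [F2 x] is the mass of the half-open interval from 0 to [x], which
   lies in the closed one. *)
have -> : F2 x = F2 x - F2 0 by rewrite F20 subr0.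
rewrite -lebesgue_stieltjes_itvoc//.
by apply: le_measure; rewrite ?inE//; apply: subset_itvr; rewrite bnd_simp.
Qed.

Lemma tail_convolution_dilate {u c x : R} : 1 < u -> 0 <= c -> 0 <= x ->
  (forall z, x / 2 <= z -> tail F1 (u * z) <= c * tail F1 z) ->
  tail (convolution F1 F2) (u * x) <=
    tail F2 (x / 2) + c * tail (convolution F1 F2) x.
Proof.
move=> u1 c0 x0 F1c.
have mI (i : interval R) : measurable ([set` i] : set (measurableTypeR R)).
  exact: measurable_itv.
have split_int (a z : R) : 0 <= a <= z -> \int[mu]_(y in `[0, z]) tail F1 (z - y) =
    \int[mu]_(y in `[0, a]) tail F1 (z - y) +
    \int[mu]_(y in `]a, z]) tail F1 (z - y).
  move=> /andP[a0 az].
  have E : `[0, z]%classic = `[0, a] `|` `]a, z]%classic.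
    by rewrite -itv_bndbnd_setU ?bnd_simp.
  rewrite E Rintegral_setU//.
    by rewrite -E; exact: integrable_tail_shift.
  by apply/disj_setPS => y [] /=; rewrite !in_itv/=; lra.
(* Both integrals are cut at the same point [x / 2], although their ranges end at [u * x] and
   [x]. *)
rewrite !tail_convolution (split_int (x / 2) (u * x)) ?(split_int (x / 2) x); [|nra..].
have near_int : \int[mu]_(y in `[0, x / 2]) tail F1 (u * x - y) <=
    c * \int[mu]_(y in `[0, x / 2]) tail F1 (x - y).
  rewrite -RintegralZl//; last exact: integrable_tail_shift.
  apply: le_Rintegral => //.
  - exact: integrable_tail_shift.
  - exact: (integrableZl (mI _) c (integrable_tail_shift _ _ (mI _))).
  - move=> y /=; rewrite in_itv/= => /andP[y0 yx].
    apply: (le_trans _ (F1c (x - y) _)); last lra.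
    by apply: tail_nonincreasing; nra.
(* Bounding the integrand by 1 leaves the mass between [x / 2] and [u * x], which telescopes with
   [tail F2 (u * x)] to [tail F2 (x / 2)]. *)
have far_int : \int[mu]_(y in `](x / 2), (u * x)]) tail F1 (u * x - y) <=
    F2 (u * x) - F2 (x / 2).
  have -> : F2 (u * x) - F2 (x / 2) = \int[mu]_(y in `](x / 2), (u * x)]) 1.
    rewrite Rintegral_cst// mul1r -[LHS]/(fine _%:E) -lebesgue_stieltjes_itvoc//; nra.
  apply: le_Rintegral => //.
  - exact: integrable_tail_shift.
  - exact: finite_measure_integrable_cst.
  - by move=> y _; exact: tail_le1.
have far_ge0 : 0 <= \int[mu]_(y in `](x / 2), x]) tail F1 (x - y).
  by apply: Rintegral_ge0 => y _; exact: tail_ge0.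
apply: (le_trans (lerD (lexx _) (lerD near_int far_int))).
have lin (p a b v w : R) : 0 <= p -> 0 <= b ->
    (1 - v) + (c * a + (v - w)) <= (1 - w) + c * (p + (a + b)).
  clear -c0 => p0 b0; have := mulr_ge0 c0 (addr_ge0 p0 b0); lra.
exact: lin (tail_ge0 F2 x) far_ge0.
Qed.
End tails.

Theorem theorem2p3 (R : realType) (F1 F2 : distrib_fun R) (f1 f2 : R -> R)
    (hf1 : positive_density F1 f1) (hf2 : positive_density F2 f2)
    (hE1 : extended_rapid_variation F1) (hE2 : extended_rapid_variation F2)
    (hbi : bounded_increase f1) (hf1_gt0 : (0 < lower_matuszewska f1)%E)
    (hlt : (lower_matuszewska (tail F1) < lower_matuszewska (tail F2))%E)
    (hliminf : exists delta : R,
      [/\ (lower_matuszewska (tail F1) <= delta%:E)%E,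
          (delta%:E < lower_matuszewska (tail F2))%E &
          (0 < limf_einf (fun x : R => (x `^ delta * tail F1 x)%:E) (+oo_R))%E]) :
  extended_rapid_variation (convolution F1 F2).
Proof.
have [u u1 /limf_esup_lt_near[c' c'1 F1c']] := hE1.
have [d [dF1 /ereal_sup_gt[_ [d0 F2d0 <-] dd0]
  /limf_einf_gt_near[m m0 F1m]]] := hliminf.
have d_ge0 : 0 <= d.
  rewrite -lee_fin (le_trans _ dF1)// lower_matuszewska_ge0//.
    by move=> x; exact: tail_ge0.
  by move=> x y; exact: tail_nonincreasing.
have F2o : x `^ d * tail F2 x @[x --> +oo] --> 0.
  apply: matuszewska_bound_cvg0 F2d0 _ => //.
  - by move=> x; exact: tail_ge0.
  - by move=> x y; exact: tail_nonincreasing.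
  - by rewrite d_ge0 -lte_fin.
(* The dilation estimate multiplies inequalities by its factor, which must be nonnegative; the
   truncation stays below 1. *)
pose c := Num.max c' 0.
have c_ge0 : 0 <= c by rewrite le_max lexx orbT.
have c_lt1 : c < 1 by rewrite gt_max c'1 ltr01.
have F20 := positive_density_at0 hf2.
have F1_dilate : \forall x \near +oo, tail F1 (u * x) <= c * tail F1 x.
  near=> x.
  have xd : 0 <= x `^ d by exact: powR_ge0.
  have F1x : m <= x `^ d * tail F1 x by near: x.
  (* The lower bound [m] excludes a vanishing tail, so the quotient bound can be cleared of its
     denominator. *)
  have F1x_gt0 : 0 < tail F1 x.
    by rewrite lt_neqAle tail_ge0 andbT; apply: contraTneq F1x => <-; rewrite mulr0 -ltNge.
  rewrite -ler_pdivrMr// (@le_trans _ _ c')//; last by rewrite le_max lexx.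
  by near: x.
exists u => //.
(* The bound is [c] from the dilation plus [(1 - c) / 2], the share allotted to the error
   [tail F2 (x / 2)]. *)
apply: (@le_lt_trans _ _ ((1 + c) / 2)%:E); last by rewrite lte_fin; lra.
apply: limf_esup_near_le.
pose eps := (1 - c) / 4 * m / 2 `^ d.
have two_d : 0 < (2 : R) `^ d by rewrite powR_gt0.
have eps_gt0 : 0 < eps.
  by rewrite /eps divr_gt0// mulr_gt0// divr_gt0//; lra.
have [A [_ F2A]] : \forall x \near +oo, x `^ d * tail F2 x <= eps.
  exact: cvgr_le F2o _ eps_gt0.
have [B [_ F1B]] := F1_dilate.
near=> x.
have x_gt0 : 0 < x by near: x; exact: nbhs_pinfty_gt.
(* The thresholds are doubled because the bounds are applied from [x / 2] on. *)
have xA : 2 * A < x by near: x; apply: nbhs_pinfty_gt; rewrite num_real.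
have xB : 2 * B < x by near: x; apply: nbhs_pinfty_gt; rewrite num_real.
have xd : 0 < x `^ d by exact: powR_gt0.
have F1x : m <= x `^ d * tail F1 x by near: x.
have F2x : 2^-1 <= F2 x.
  by near: x; apply: (cvgr_ge _ (cumulativey F2)); lra.
have F2_half : (x / 2) `^ d * tail F2 (x / 2) <= eps.
  by apply: F2A; lra.
have dilate z : x / 2 <= z -> tail F1 (u * z) <= c * tail F1 z.
  by move=> xz; apply: F1B; lra.
have H_ge := tail_convolution_ge F1 F2 (ltW x_gt0) F20.
have H_le := tail_convolution_dilate F1 F2 u1 c_ge0 (ltW x_gt0) dilate.
set H := tail (convolution F1 F2) in H_ge H_le *.
have F1x_gt0 : 0 < tail F1 x.
  by rewrite -(pmulr_rgt0 _ xd) (lt_le_trans m0).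
have Hx : 2^-1 * tail F1 x <= H x.
  by rewrite (le_trans _ H_ge)// mulrC ler_wpM2l// ltW.
have F2H : tail F2 (x / 2) <= (1 - c) / 2 * H x.
  have xdE : x `^ d = 2 `^ d * (x / 2) `^ d.
    by rewrite -powRM; [congr (_ `^ _); lra| |lra].
  rewrite -(ler_pM2l xd) {1}xdE.
  have mH : m <= x `^ d * (2 * H x).
    by rewrite (le_trans F1x)// ler_pM2l//; lra.
  have c2 : 0 <= (1 - c) / 4 by lra.
  apply: (@le_trans _ _ ((1 - c) / 4 * m)); last first.
    by rewrite (le_trans (ler_wpM2l c2 mH))// le_eqVlt; apply/orP; left; apply/eqP; field.
  have -> : (1 - c) / 4 * m = 2 `^ d * eps by rewrite [RHS]mulrC /eps mulfVK ?gt_eqF.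
  by rewrite -mulrA ler_pM2l.
have Hx_gt0 : 0 < H x by rewrite (lt_le_trans _ Hx)// mulr_gt0.
rewrite ler_pdivrMr// (le_trans H_le)// (le_trans (lerD F2H (lexx _)))//.
by rewrite -mulrDl le_eqVlt; apply/orP; left; apply/eqP; field.
Unshelve. all: by end_near. Qed.
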